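(* Let $n$ be a positive integer, let $s$ be a positive real number, and let $P_n(s,z)=\sum_{k=0}^{n} s^{(k)} z^{n-k}$, viewed as a polynomial in $z$ of degree $n$ with complex roots. (i) If $n$ is even, then $P_n(s,z)$ has exactly one root in each of the $(n+1)$-regular open angular sectors, except the one containing the negative real line. (ii) If $n$ is odd, then $P_n(s,z)$ has exactly one negative real root, this root lies in the open interval $\left(-\left(s^{(n+1)}\right)^{1/(n+1)},\, 0\right)$, and $P_n(s,z)$ has exactly one root in each of the $(n+1)$-regular open angular sectors except the two adjacent to the negative real line. In particular, the roots of $P_n(s,z)$ are simple.
   Context: The ascending factorial is $s^{(0)}=1$ and $s^{(k)}=s(s+1)\cdots(s+k-1)$ for $k\ge 1$. For a positive integer $p$, the $p$-regular open angular sectors are the $p$ open angular sectors of the complex plane delimited by two half-lines originating at $0$ and passing through two successive $p$-th roots of unity, i.e. the sets $\{re^{i\varphi} : r>0,\ 2\pi \ell/p<\varphi<2\pi(\ell+1)/p\}$ for $\ell=0,\dots,p-1$. The negative real line is $\{x\in\mathbb{R}: x<0\}$; a sector is adjacent to it if the negative real line is one of its two bounding half-lines. *)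

(* Defs.v *)
From HB Require Import structures.
From mathcomp Require Export all_boot all_order all_algebra.
From mathcomp Require Export complex.
From mathcomp Require Export all_classical all_reals all_analysis.

Set Implicit Arguments.
Unset Strict Implicit.
Unset Printing Implicit Defensive.

Import Order.TTheory GRing.Theory Num.Theory.

Local Open Scope classical_set_scope.
Local Open Scope ring_scope.
Local Open Scope complex_scope.

Definition ascfact (R : realType) (s : R) (k : nat) : R :=
  \prod_(i < k) (s + i%:R).

Definition Pn (R : realType) (n : nat) (s : R) : {poly R[i]} :=
  \sum_(k < n.+1) (ascfact s k)%:C *: 'X^(n - k).

Definition expi (R : realType) (phi : R) : R[i] := cos phi +i* sin phi.

(* 2 pi l / p, the argument of the l-th p-th root of unity *)
Definition root_angle (R : realType) (p l : nat) : R :=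
  2 * pi * l%:R / p%:R.
Arguments root_angle : clear implicits.

(* The half-line from 0 through the l-th p-th root of unity.  The origin is
   left out, as it is in negative_real_line. *)
Definition half_line (R : realType) (p l : nat) : set R[i] :=
  [set z | exists2 r : R, 0 < r & z = r%:C * expi (root_angle R p l)].
Arguments half_line : clear implicits.

Definition sector (R : realType) (p l : nat) : set R[i] :=
  [set z | exists r phi : R,
    [/\ 0 < r, root_angle R p l < phi < root_angle R p l.+1
      & z = r%:C * expi phi]].
Arguments sector : clear implicits.

Definition negative_real_line (R : realType) : set R[i] :=
  [set z | exists2 x : R, x < 0 & z = x%:C].
Arguments negative_real_line : clear implicits.

Definition adjacent_to_negative (R : realType) (p l : nat) : Prop :=
  negative_real_line R = half_line R p l \/
  negative_real_line R = half_line R p l.+1.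
Arguments adjacent_to_negative : clear implicits.

(* exists! counts distinct points; multiplicities are dealt with through mup. *)
Definition one_root_in (R : realType) (P : {poly R[i]}) (A : set R[i]) : Prop :=
  exists! z : R[i], A z /\ root P z.

(* Main.v *)
Require Import Defs.
From mathcomp Require Import zify ring lra polyrcf.

(* The functional t^k |-> s^(k) is integration against a Gamma density, hence
   positive on polynomials that are nonnegative on [0, +oo).  If e^(i N a) = 1
   with N = n + 1 and |a| < pi, then Re (e^(i a/2) P_n(s, r e^(i a))) is the
   value of this functional at
     \sum_(k <= n) r^(n-k) cos ((k + 1/2) a) t^k
       = cos (a/2) (r - t) (r^N - t^N) / (t^2 - 2 r t cos a + r^2) >= 0,
   so it is positive.  Therefore P_n has no root on these rays, and along each
   of them the argument of e^(i a/2) P_n stays within (-pi/2, pi/2).  Writing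
   the variation of the argument as the sum of the contributions of the roots
   gives the sum of the arguments of -z e^(-i a) over the roots z: it is equal
   to a.  Comparing two rays counts the roots between them. *)

Set Implicit Arguments.
Unset Strict Implicit.
Unset Printing Implicit Defensive.

Import Order.TTheory GRing.Theory Num.Theory.
Import numFieldTopology.Exports numFieldNormedType.Exports.

Local Open Scope classical_set_scope.
Local Open Scope ring_scope.
Local Open Scope complex_scope.

(** * Positivity of the functional [t^k |-> s^(k)] *)

Section MomentFunctional.
Context {R : realType}.
Implicit Types (s t : R) (y : {poly R}).

Lemma ascfactS s k : ascfact s k.+1 = ascfact s k * (s + k%:R).
Proof. by rewrite /ascfact big_ord_recr. Qed.

Lemma ascfact_gt0 s k : 0 < s -> 0 < ascfact s k.
Proof. by move=> s0; apply: prodr_gt0 => i _; rewrite ltr_wpDr. Qed.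

(** The right-hand side times [t^(s-1) e^-t] is the derivative of [t^s e^-t y(t)]: modulo such exact
    terms, [t^k] equals the constant [s^(k)]. The induction on [k] is the integration by parts
    behind [Gamma(s+k+1) = (s+k) Gamma(s+k)]. *)
Lemma monomial_primitive s k : exists y,
  'X^k - (ascfact s k)%:P = 'X * y^`() + (s%:P - 'X) * y.
Proof.
elim: k => [|k [y IH]].
  by exists 0; rewrite /ascfact big_ord0 expr0 polyC1 subrr derivC !mulr0 addr0.
exists ((s + k%:R) *: y - 'X^k).
rewrite ascfactS derivB derivZ derivXn mulrBr -scalerAr.
have -> : 'X * ('X^(k.-1) *+ k) = k%:R%:P * 'X^k :> {poly R}.
  case: k {IH} => [|k]; first by rewrite mulr0n mulr0 mul0r.
  by rewrite mulrnAr /= -exprS polyC_natr mulr_natl.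
rewrite -!mul_polyC polyCM polyCD exprS.
have -> : 'X^k = 'X * y^`() + (s%:P - 'X) * y + (ascfact s k)%:P by rewrite -IH subrK.
by ring.
Qed.

Lemma combination_primitive s n (f : nat -> R) : exists y,
  \sum_(k < n) f k *: 'X^k - (\sum_(k < n) f k * ascfact s k)%:P =
  'X * y^`() + (s%:P - 'X) * y.
Proof.
have [y yE] := choice (monomial_primitive s).
exists (\sum_(k < n) f k *: y k).
have -> : (\sum_(k < n) f k *: y k)^`() = \sum_(k < n) (f k *: y k)^`().
  exact: raddf_sum.
rewrite !mulr_sumr rmorph_sum -sumrB -big_split /=.
apply: eq_bigr => k _.
by rewrite derivZ -!scalerAr -scalerDr -yE scalerBr polyCM mul_polyC.
Qed.

(* [t^s e^-t y(t)] has derivative [t^(s-1) e^-t (t y' + (s - t) y)]. *)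
Lemma no_positive_supersolution s y : 0 < s -> 0 < y.[0] ->
  (forall t, 0 < t -> 0 <= t * y^`().[t] + (s - t) * y.[t]) -> False.
Proof.
move=> s0 y0 Hy.
have yN0 : y != 0 by apply: contraTneq y0 => ->; rewrite horner0 ltxx.
(* The product [t y'] has degree at most that of [y], so [- t y] alone gives the leading term. *)
have lcE : lead_coef ('X * y^`() + (s%:P - 'X) * y) = - lead_coef y.
  have lX : lead_coef (s%:P - 'X) = -1 :> R.
    by rewrite lead_coefDr ?lead_coefN ?lead_coefX// size_polyN size_polyX size_polyC;
       case: (s != 0).
  have sX : size (s%:P - 'X) = 2%N.
    by rewrite addrC size_polyDl ?size_polyN ?size_polyX// size_polyC; case: (s != 0).
  have XN0 : s%:P - 'X != 0 by rewrite -size_poly_eq0 sX.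
  rewrite lead_coefDr ?lead_coefM ?lX ?mulN1r// (size_mul XN0 yN0) sX /=.
  have [->|y'N0] := eqVneq y^`() 0.
    by rewrite mulr0 size_poly0.
  by rewrite mulrC size_mulX// ltnS lt_size_deriv.
(* By [lcE], a positive leading coefficient of [y] would make the expression of [Hy] negative for
   large [t]. So the leading coefficient is negative, and [y] is eventually negative. *)
have [b b0 yb] : exists2 b, 0 < b & y.[b] < 0.
  have lcy : lead_coef y < 0.
    rewrite ltNge; apply/negP => lcy.
    have lcy0 : 0 < lead_coef y by rewrite lt_neqAle eq_sym lead_coef_eq0 yN0.
    have [M HM] := @poly_pinfty_gt_lc _ (- ('X * y^`() + (s%:P - 'X) * y))
      ltac:(by rewrite lead_coefN lcE opprK).
    have M1 : M <= `|M| + 1 by rewrite ler_wpDr// ler_norm.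
    have M0 : 0 < `|M| + 1 by rewrite ltr_wpDl.
    have := Hy _ M0; have := HM _ M1; rewrite lead_coefN lcE opprK !hornerE.
    by move: (y.[_]) (y^`().[_]) lcy0 => u v; lra.
  have [M HM] := @poly_pinfty_gt_lc _ (- y) ltac:(by rewrite lead_coefN oppr_gt0).
  exists (`|M| + 1); first by rewrite ltr_wpDl.
  have := HM (`|M| + 1); rewrite ler_wpDr ?ler_norm// => /(_ isT).
  by rewrite lead_coefN hornerN; lra.
have [e e0 He] := poly_cont 0 y y0.
pose a := Num.min (b / 2) (e / 2).
have a0 : 0 < a by rewrite lt_min !divr_gt0.
have ab : a <= b by rewrite ge_min; apply/orP; left; lra.
have ya : 0 < y.[a].
  have ae : `|a - 0| < e.
    by rewrite subr0 gtr0_norm// gt_min; apply/orP; right; lra.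
  by have /ltr_normlP[] := He a ae; lra.
pose F (t : R) := (t `^ s * expR (- t)) * y.[t].
have dF (t : R) : 0 < t -> is_derive t 1 F
    (t `^ (s - 1) * expR (- t) * (t * y^`().[t] + (s - t) * y.[t])).
  move=> t0; rewrite /F.
  have h1 := is_derive1_powR s t0.
  apply: is_derive_eq.
  rewrite /GRing.scale /=.
  have -> : t `^ s = t * t `^ (s - 1).
    by rewrite mulr_powRB1 ?ltW.
  by ring.
(* The contradiction: [F] does not decrease on [[a, b]], yet it has the sign of [y], positive at [a]
   and negative at [b]. *)
have F_ge : F a <= F b.
  apply: (@ger0_derive1_ndecr _ F a b) => // [x|x|].
  - rewrite in_itv/= => /andP[ax _].
    by have [] := dF x (lt_trans a0 ax).
  - rewrite in_itv/= => /andP[ax _].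
    have x0 := lt_trans a0 ax.
    rewrite derive1E; have [_ ->] := dF x x0.
    by rewrite mulr_ge0 ?Hy// mulr_ge0 ?powR_ge0 ?expR_ge0.
  - apply: derivable_within_continuous => x; rewrite in_itv/= => /andP[ax _].
    by have [] := dF x (lt_le_trans a0 ax).
have : 0 < F a by rewrite /F mulr_gt0// mulr_gt0 ?powR_gt0 ?expR_gt0.
have : F b < 0 by rewrite /F pmulr_rlt0// mulr_gt0 ?powR_gt0 ?expR_gt0.
by lra.
Qed.

(* [p |-> \sum_k p_k s^(k)] is integration against the Gamma density
   [t^(s-1) e^-t / Gamma(s)]; positivity is obtained without integrals. *)
Lemma ascfact_moment_gt0 s n (f : nat -> R) : 0 < s ->
  (forall t, 0 <= t -> 0 <= \sum_(k < n.+1) f k * t ^+ k) -> 0 < f 0%N ->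
  0 < \sum_(k < n.+1) f k * ascfact s k.
Proof.
move=> s0 Hf f0; rewrite ltNge; apply/negP => c0.
have [y yE] := combination_primitive s n.+1 f.
have hyE t : \sum_(k < n.+1) f k * t ^+ k - \sum_(k < n.+1) f k * ascfact s k =
    t * y^`().[t] + (s - t) * y.[t].
  have := congr1 (fun q : {poly R} => q.[t]) yE.
  rewrite !hornerE /= horner_sum => <-.
  by congr (_ - _); apply: eq_bigr => k _; rewrite hornerZ hornerXn.
apply: (@no_positive_supersolution s y) => // [|t t0]; last first.
  by rewrite -hyE subr_ge0 (le_trans c0)// Hf// ltW.
(* At [t = 0] the identity reads [f 0 - c = s y(0)], where [c <= 0] is the sum assumed nonpositive;
   hence [y(0) > 0]. *)
have := hyE 0; rewrite mul0r add0r subr0 big_ord_recl expr0 mulr1.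
rewrite [X in _ + X - _]big1 => [|i _]; last by rewrite expr0n mulr0.
rewrite addr0 => h; have : 0 < s * y.[0] by rewrite -h; lra.
by rewrite pmulr_rgt0.
Qed.
End MomentFunctional.

(** * Positivity of the real part of [e^(i a/2) P_n] along the rays *)

Section RayPositivity.
Context {R : realType}.
Implicit Types (s t r a b : R).

Lemma expiD a b : expi (a + b) = expi a * expi b.
Proof.
by apply/eqP; rewrite eq_complex /= cosD sinD; apply/andP; split; apply/eqP; ring.
Qed.

Lemma expi0 : expi (0 : R) = 1.
Proof. by rewrite /expi cos0 sin0. Qed.

Lemma expiMn a k : expi (k%:R * a) = expi a ^+ k.
Proof.
elim: k => [|k IH]; first by rewrite mul0r expi0.
by rewrite -natr1 mulrDl mul1r expiD IH exprSr.
Qed.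

(** The quadratic factor matches the recurrence [cos (x + a) = 2 cos a cos x - cos (x - a)], so that
    only boundary terms survive. At the lower end, [cos (a/2 - a) = cos (a/2)]. *)
Lemma cos_sum_telescope r t a n :
  (t ^+ 2 - r * t * cos a *+ 2 + r ^+ 2) *
    (\sum_(k < n.+1) r ^+ (n - k) * cos (a / 2 + k%:R * a) * t ^+ k) =
  cos (a / 2) * r ^+ n.+1 * (r - t) +
    t ^+ n.+1 * (t * cos (a / 2 + n%:R * a) - r * cos (a / 2 + n.+1%:R * a)).
Proof.
have C1 : cos (a / 2 + a) = cos a * cos (a / 2) *+ 2 - cos (a / 2).
  have h : cos (a / 2 - a) = cos (a / 2) by rewrite -cosN; congr cos; field.
  rewrite -{2}h cosB cosD; ring.
elim: n => [|n IH].
  by rewrite big_ord_recl big_ord0 subn0 !expr0 mul0r !addr0 [1%:R * a]mul1r C1; ring.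
have Cn : cos (a / 2 + n.+2%:R * a) =
    cos a * cos (a / 2 + n.+1%:R * a) *+ 2 - cos (a / 2 + n%:R * a).
  have -> : a / 2 + n.+2%:R * a = a / 2 + n.+1%:R * a + a by rewrite -[in LHS]natr1; ring.
  have -> : a / 2 + n%:R * a = a / 2 + n.+1%:R * a - a by rewrite -[in RHS]natr1; ring.
  by rewrite cosB cosD; ring.
rewrite big_ord_recr /= subnn expr0 mul1r.
under eq_bigr => i _ do
  rewrite subSn ?leq_ord// exprS -2!mulrA [X in r * X]mulrA.
rewrite -mulr_sumr mulrDr mulrCA IH Cn !exprS; ring.
Qed.

Lemma cos_root_sum_ge0 r t a n : 0 < r -> 0 <= t -> - pi < a < pi ->
  cos (n.+1%:R * a) = 1 ->
  0 <= \sum_(k < n.+1) r ^+ (n - k) * cos (a / 2 + k%:R * a) * t ^+ k.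
Proof.
move=> r0 t0 /andP[aL aR] ca.
have cpos : 0 < cos (a / 2) by apply: cos_gt0_pihalf; apply/andP; split; lra.
have sa : sin (n.+1%:R * a) = 0.
  by apply/eqP; rewrite -sqrf_eq0 sin2cos2 ca expr1n subrr.
have CN : cos (a / 2 + n.+1%:R * a) = cos (a / 2) by rewrite cosD ca sa; ring.
have Cn : cos (a / 2 + n%:R * a) = cos (a / 2).
  have -> : a / 2 + n%:R * a = n.+1%:R * a - a / 2 by rewrite -natr1; field.
  by rewrite cosB ca sa; ring.
have := cos_sum_telescope r t a n; rewrite Cn CN.
set S := (\sum_(k < _) _); set D := _ - _ + _ => SE.
(* This form shows [D >= 0]. It also shows that [D = 0] forces [t = r] and [cos a = 1]; all the
   cosines of the sum are then equal to [cos (a/2)], and no division by [D] is needed. *)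
have DE : D = (t - r) ^+ 2 + r * t * (1 - cos a) *+ 2 by rewrite /D; ring.
have D0 : 0 <= r * t * (1 - cos a) by rewrite !mulr_ge0 ?subr_ge0 ?cos_le1// ltW.
have [Dpos|] := ltP 0 D.
  rewrite -(pmulr_rge0 _ Dpos) SE.
  have -> : cos (a / 2) * r ^+ n.+1 * (r - t) +
    t ^+ n.+1 * (t * cos (a / 2) - r * cos (a / 2)) =
    cos (a / 2) * ((r - t) * (r ^+ n.+1 - t ^+ n.+1)) by ring.
  rewrite mulr_ge0 ?(ltW cpos)//.
  have [rt|/ltW tr] := leP r t.
    by rewrite mulr_le0 ?subr_le0// lerXn2r// nnegrE// ltW.
  by rewrite mulr_ge0 ?subr_ge0// lerXn2r// nnegrE// ltW.
move=> Dle.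
have tr : t = r.
  by have := sqr_ge0 (t - r) => ?; apply/eqP; rewrite -subr_eq0 -sqrf_eq0; apply/eqP; lra.
have ca1 : cos a = 1.
  have /eqP : r * t * (1 - cos a) = 0 by have := sqr_ge0 (t - r); lra.
  by rewrite tr !mulf_eq0 (gt_eqF r0) /= subr_eq0 => /eqP.
have sa1 : sin a = 0 by apply/eqP; rewrite -sqrf_eq0 sin2cos2 ca1 expr1n subrr.
have Ck k : cos (a / 2 + k%:R * a) = cos (a / 2).
  elim: k => [|k IH]; first by rewrite mul0r addr0.
  by rewrite -[k.+1%:R]natr1 mulrDl mul1r addrA cosD ca1 sa1 IH; ring.
by apply: sumr_ge0 => k _; rewrite Ck !mulr_ge0 ?exprn_ge0// ltW.
Qed.

Lemma Re_real_mul a (z : R[i]) : complex.Re (a%:C * z) = a * complex.Re z.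
Proof. by case: z => x y /=; rewrite mul0r subr0. Qed.

Lemma Pn_ray_gt0 n s r a : 0 < s -> 0 <= r -> - pi < a < pi ->
  cos (n.+1%:R * a) = 1 ->
  0 < complex.Re (expi (a / 2) * (Pn n s).[r%:C * expi a]).
Proof.
move=> s0 r0 ha ca.
have cpos : 0 < cos (a / 2).
  by case/andP: ha => ? ?; apply: cos_gt0_pihalf; apply/andP; split; lra.
have sa : sin (n.+1%:R * a) = 0.
  by apply/eqP; rewrite -sqrf_eq0 sin2cos2 ca expr1n subrr.
have -> : complex.Re (expi (a / 2) * (Pn n s).[r%:C * expi a]) =
  \sum_(k < n.+1) r ^+ (n - k) * cos (a / 2 + k%:R * a) * ascfact s k.
  rewrite /Pn horner_sum mulr_sumr raddf_sum; apply: eq_bigr => k _.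
  rewrite hornerZ hornerXn exprMn -rmorphXn /= mulrCA [_%:C * expi _ ^+ _]mulrC.
  rewrite [expi (a / 2) * _]mulrA [_ * (r ^+ _)%:C]mulrC !Re_real_mul.
  rewrite -expiMn -expiD /= mulrC; congr (_ * _ * _).
  (* Since [e^(i(n+1)a) = 1], the cosines of [a/2 + (n-k) a] and [a/2 + k a] agree. *)
  have -> : a / 2 + (n - k)%:R * a = n.+1%:R * a - (a / 2 + k%:R * a).
    by rewrite natrB ?leq_ord// -natr1; field.
  by rewrite cosB ca sa; ring.
(* At [r = 0] the constant coefficient required to be positive by [ascfact_moment_gt0] vanishes if
   [n > 0]. There only the term [k = n] is left, with value [cos (a/2) s^(n)]. *)
have [r0'|] := ltP 0 r; last first.
  move=> r0'; have -> : r = 0 by apply/eqP; rewrite eq_le r0 r0'.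
  rewrite big_ord_recr /= big1 ?add0r => [|i _].
    rewrite subnn expr0 mul1r mulr_gt0 ?ascfact_gt0//.
    have -> : a / 2 + n%:R * a = n.+1%:R * a - a / 2 by rewrite -natr1; field.
    by rewrite cosB ca sa mul1r mul0r addr0.
  by rewrite expr0n subn_eq0 leqNgt ltn_ord /= !mul0r.
apply: (@ascfact_moment_gt0 _ s n (fun k => r ^+ (n - k) * cos (a / 2 + k%:R * a))) => //.
  by move=> t t0; apply: cos_root_sum_ge0.
by rewrite mul0r addr0 mulr_gt0// exprn_gt0.
Qed.
End RayPositivity.

(** * The principal argument on the slit plane *)

Section Argument.
Context {R : realType}.
Implicit Types (a b r : R) (z w : R[i]).

Local Notation normc := (@Normc.normc R).

(* [slit z] says that [z] is not in [(-oo, 0]]; there, [carg z] is the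
   principal argument, by the half-angle formula. *)
Definition slit z := (complex.Im z != 0) || (0 < complex.Re z).
Definition carg z := 2 * atan (complex.Im z / (complex.Re z + normc z)).

Lemma carg_bound z : - pi < carg z < pi.
Proof.
have := @atan_gtNpi2 R (complex.Im z / (complex.Re z + normc z)).
have := @atan_ltpi2 R (complex.Im z / (complex.Re z + normc z)).
by rewrite /carg => h1 h2; apply/andP; split; lra.
Qed.

Lemma slit_denom_gt0 z : slit z -> 0 < complex.Re z + normc z.
Proof.
case: z => x y; rewrite /slit /= => /orP[y0|x0]; last first.
  by rewrite ltr_wpDr ?sqrtr_ge0.
suff : `|x| < Num.sqrt (x ^+ 2 + y ^+ 2) by have := ler_norm (- x); rewrite normrN; lra.
by rewrite -sqrtr_sqr ltr_sqrt ?ltrDl ?exprn_even_gt0// ltr_wpDl ?sqr_ge0// exprn_even_gt0.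
Qed.

Lemma normc_gt0 z : slit z -> 0 < normc z.
Proof.
case: z => x y; rewrite /slit /= sqrtr_gt0 => /orP[y0|x0].
  by rewrite ltr_wpDl ?sqr_ge0// exprn_even_gt0.
by rewrite ltr_wpDr ?sqr_ge0// exprn_gt0.
Qed.

Lemma carg_expi r a : 0 < r -> - pi < a < pi -> carg (r%:C * expi a) = a.
Proof.
move=> r0 /andP[aL aR].
have ch : 0 < cos (a / 2) by apply: cos_gt0_pihalf; apply/andP; split; lra.
rewrite /carg /= !mul0r subr0 addr0 !exprMn -mulrDr cos2Dsin2 mulr1 sqrtr_sqr gtr0_norm//.
have -> : r * sin a / (r * cos a + r) = tan (a / 2).
  have aE : a = a / 2 + a / 2 by field.
  have -> : sin a = sin (a / 2) * cos (a / 2) *+ 2 by rewrite [in LHS]aE sinD; ring.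
  have -> : cos a = cos (a / 2) ^+ 2 *+ 2 - 1.
    by rewrite [in LHS]aE cosD; have := cos2Dsin2 (a / 2); lra.
  have -> : r * (cos (a / 2) ^+ 2 *+ 2 - 1) + r = 2 * r * cos (a / 2) ^+ 2 by ring.
  by rewrite /tan; field; rewrite !gt_eqF.
rewrite tanK; first by field.
by rewrite in_itv /=; apply/andP; split; lra.
Qed.

(** With [q = y / (x + h)] the half-angle tangent, the cosine and sine of [2 atan q] are
    [(1 - q^2) / (1 + q^2)] and [2 q / (1 + q^2)]. The relation [y^2 = (h - x)(h + x)] turns them
    into [x / h] and [y / h]. *)
Lemma polar_form z : slit z -> z = (normc z)%:C * expi (carg z).
Proof.
move=> sz; have := slit_denom_gt0 sz; have := normc_gt0 sz.
case: z {sz} => x y; rewrite /carg; set h := normc _.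
have hE : h ^+ 2 = x ^+ 2 + y ^+ 2 by rewrite sqr_sqrtr// addr_ge0 ?sqr_ge0.
move: h hE => h hE h0 /= d0.
set q := y / (x + h).
have c2 : cos (atan q) ^+ 2 = (1 + q ^+ 2)^-1.
  by rewrite cos_atan exprVn sqr_sqrtr// addr_ge0 ?sqr_ge0.
have sE : sin (atan q) = q * cos (atan q).
  have qt : sin (atan q) / cos (atan q) = q by exact: atanK.
  rewrite -{2}qt mulfVK// cos_atan invr_eq0 sqrtr_eq0 -ltNge.
  by rewrite ltr_wpDr ?sqr_ge0.
have q2 : 1 + q ^+ 2 = 2 * h / (x + h).
  have -> : q ^+ 2 = y ^+ 2 / (x + h) ^+ 2 by rewrite exprMn exprVn.
  have -> : y ^+ 2 = (h - x) * (x + h) by rewrite mulrDr !mulrBl; lra.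
  by field; rewrite gt_eqF.
have q20 : 1 + q ^+ 2 != 0 by rewrite q2 gt_eqF// divr_gt0// mulr_gt0.
have e2 : 2 * atan q = atan q + atan q by ring.
apply/eqP; rewrite eq_complex /= e2 cosD sinD sE !mul0r subr0 addr0.
have -> : cos (atan q) * cos (atan q) - q * cos (atan q) * (q * cos (atan q)) =
  (1 - q ^+ 2) * cos (atan q) ^+ 2 by ring.
have -> : q * cos (atan q) * cos (atan q) + cos (atan q) * (q * cos (atan q)) =
  2 * q * cos (atan q) ^+ 2 by ring.
rewrite c2.
have hx : (x + h) ^+ 2 * (1 + q ^+ 2) = 2 * h * (x + h).
  by rewrite q2; field; rewrite gt_eqF.
have qE : q * (x + h) = y by rewrite mulfVK// gt_eqF.
have q1 : 1 - q ^+ 2 = 2 * x / (x + h).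
  have -> : 1 - q ^+ 2 = 2 - (1 + q ^+ 2) by ring.
  by rewrite q2; field; rewrite gt_eqF.
apply/andP; split; apply/eqP; rewrite q2 ?q1 /q; field; rewrite !gt_eqF//.
Qed.
End Argument.

(** * Variation of the sum of the arguments along a ray *)

Section ArgumentSum.
Context {R : realType}.
Implicit Types (a b r u : R) (z w : R[i]) (ws : seq R[i]).

Local Notation normc := (@Normc.normc R).

(* Up to the factor [1 - u], this is the ray [r - w] with [r = u / (1 - u)]; it
   reaches [1] at [u = 1], so that no limit at infinity is needed. *)
Definition ray_path w u : R[i] := u%:C - (1 - u)%:C * w.

Lemma Re_ray_path w u : complex.Re (ray_path w u) = u - (1 - u) * complex.Re w.
Proof. by case: w => x y; rewrite /ray_path /= !mul0r subr0. Qed.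

Lemma Im_ray_path w u : complex.Im (ray_path w u) = - (1 - u) * complex.Im w.
Proof. by case: w => x y; rewrite /ray_path /=; ring. Qed.

(** The path is the segment from [- w] to [1], and the slit plane is star-shaped about [1]. *)
Lemma slit_ray_path w u : slit (- w) -> 0 <= u <= 1 -> slit (ray_path w u).
Proof.
rewrite /slit Re_ray_path Im_ray_path; case: w => x y /=.
move=> + /andP[u0]; rewrite le_eqVlt => + /predU1P[->|u1].
  by rewrite subrr mul0r subr0 ltr01 orbT.
rewrite mulf_eq0 oppr_eq0 oppr_eq0 subr_eq0 (gt_eqF u1) /= => /orP[->//|x0].
by have := mulr_gt0 (_ : 0 < 1 - u) x0; rewrite subr_gt0 => /(_ u1) h; apply/orP; right; lra.
Qed.

Lemma continuous_carg_ray_path w u : slit (- w) -> 0 <= u <= 1 ->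
  {for u, continuous (fun v => carg (ray_path w v))}.
Proof.
move=> sw hu; have := slit_denom_gt0 (slit_ray_path sw hu).
pose X v := v - (1 - v) * complex.Re w; pose Y v := - (1 - v) * complex.Im w.
have nE v : normc (ray_path w v) = Num.sqrt (X v ^+ 2 + Y v ^+ 2).
  by rewrite /X /Y -Re_ray_path -Im_ray_path; case: (ray_path w v).
have -> : (fun v => carg (ray_path w v)) =
    (fun v => 2 * atan (Y v / (X v + Num.sqrt (X v ^+ 2 + Y v ^+ 2)))).
  by apply/funext => v; rewrite /carg nE Re_ray_path Im_ray_path.
rewrite nE Re_ray_path -/(X u) => d0.
have cB : (fun v : R => 1 - v) @ u --> 1 - u.
  by apply: cvgB; [exact: cvg_cst|exact: cvg_id].
have cX : X @ u --> X u.
  by apply: cvgB; [exact: cvg_id|apply: cvgM => //; exact: cvg_cst].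
have cY : Y @ u --> Y u.
  by apply: cvgM; [exact: cvgN|exact: cvg_cst].
have cS : (fun v => Num.sqrt (X v ^+ 2 + Y v ^+ 2)) @ u -->
    Num.sqrt (X u ^+ 2 + Y u ^+ 2).
  apply: (@continuous_comp _ _ _ (fun v => X v ^+ 2 + Y v ^+ 2) Num.sqrt); last first.
    exact: sqrt_continuous.
  by apply: cvgD; rewrite expr2; apply: cvgM.
apply: cvgM; first exact: cvg_cst.
apply: (@continuous_comp _ _ _ (fun v => Y v / (X v + Num.sqrt (X v ^+ 2 + Y v ^+ 2))) atan);
  last exact: continuous_atan.
apply: cvgM => //; apply: cvgV; first by rewrite gt_eqF.
exact: cvgD.
Qed.

Lemma expi_sum ws (f : R[i] -> R) :
  expi (\sum_(w <- ws) f w) = \prod_(w <- ws) expi (f w).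
Proof.
elim: ws => [|w ws IH]; first by rewrite !big_nil expi0.
by rewrite !big_cons expiD IH.
Qed.

Lemma polar_form_prod ws : {in ws, forall w, slit w} ->
  exists2 r, 0 < r & \prod_(w <- ws) w = r%:C * expi (\sum_(w <- ws) carg w).
Proof.
move=> sws; exists (\prod_(w <- ws) normc w).
  by rewrite big_seq; apply: prodr_gt0 => w /sws; exact: normc_gt0.
rewrite expi_sum rmorph_prod -big_split /= big_seq [RHS]big_seq.
by apply: eq_bigr => w /sws; exact: polar_form.
Qed.

(** The sum [A u] of the arguments along the paths is continuous and vanishes at [u = 1]. If it left
    the window [(b - pi/2, b + pi/2)], it would reach an endpoint, where the real part in the
    hypothesis is zero. The conclusion is the case [u = 0]. *)
Lemma carg_sum_bound ws b : {in ws, forall w, slit (- w)} ->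
  - (pi / 2) < b < pi / 2 ->
  (forall u, 0 <= u <= 1 ->
     0 < complex.Re (expi (- b) * \prod_(w <- ws) ray_path w u)) ->
  - (pi / 2) < \sum_(w <- ws) carg (- w) - b < pi / 2.
Proof.
move=> sws hb Hre.
pose A u := \sum_(w <- ws) carg (ray_path w u).
have cA : {within `[0, 1], continuous A}.
  apply: continuous_in_subspaceT => u; rewrite inE /= in_itv /= => hu.
  rewrite /A; elim: ws sws {Hre A} => [|w ws IH] sws.
    have -> : (fun v => \sum_(w <- [::]) carg (ray_path w v)) = cst 0.
      by apply/funext => v; rewrite big_nil.
    exact: cvg_cst.
  have -> : (fun v => \sum_(z <- w :: ws) carg (ray_path z v)) =
      (fun v => carg (ray_path w v) + \sum_(z <- ws) carg (ray_path z v)).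
    by apply/funext => v; rewrite big_cons.
  apply: cvgD.
    by apply: continuous_carg_ray_path => //; apply: sws; rewrite mem_head.
  by apply: IH => v vws; apply: sws; rewrite in_cons vws orbT.
have cosA u : 0 <= u <= 1 -> 0 < cos (A u - b).
  move=> hu; have := Hre u hu.
  have [|r r0] := @polar_form_prod [seq ray_path w u | w <- ws].
    by move=> _ /mapP[w wws ->]; apply: slit_ray_path => //; apply: sws.
  rewrite !big_map => ->; rewrite mulrCA -expiD Re_real_mul pmulr_rgt0//.
  by rewrite addrC.
have A1 : A 1 = 0.
  rewrite /A big1 // => w _; rewrite /carg Im_ray_path subrr oppr0 !mul0r.
  by rewrite atan0 mulr0.
have A0 : A 0 = \sum_(w <- ws) carg (- w).
  apply: eq_bigr => w _; congr carg.
  by rewrite /ray_path subr0 mul1r sub0r.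
rewrite -A0; case/andP: hb => hb1 hb2.
apply/andP; split; rewrite ltNge; apply/negP => hA.
  have [c] : exists2 c, c \in `[0, 1] & A c = b - pi / 2.
    apply: IVT => //; rewrite A1 ge_min le_max; apply/andP; split; apply/orP; [left|right]; lra.
  rewrite in_itv /= => hc Ac; have := cosA c hc.
  have -> : A c - b = - (pi / 2) by rewrite Ac; ring.
  by rewrite cosN cos_pihalf ltxx.
have [c] : exists2 c, c \in `[0, 1] & A c = b + pi / 2.
  apply: IVT => //; rewrite A1 ge_min le_max; apply/andP; split; apply/orP; [right|left]; lra.
rewrite in_itv /= => hc Ac; have := cosA c hc.
have -> : A c - b = pi / 2 by rewrite Ac; ring.
by rewrite cos_pihalf ltxx.
Qed.
End ArgumentSum.

(** * The sum of the arguments of the rotated roots *)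

Section RootArguments.
Context {R : realType}.
Implicit Types (a s r u : R) (z w : R[i]) (zs : seq R[i]).

Lemma Pn_monic n s : size (Pn n s) = n.+1 /\ Pn n s \is monic.
Proof.
rewrite /Pn big_ord_recl /= subn0 /ascfact big_ord0 scale1r.
set q := \sum_(i < n) _.
have sq : (size q < size ('X^n : {poly R[i]}))%N.
  rewrite size_polyXn ltnS; apply: (leq_trans (size_sum _ _ _)).
  apply/bigmax_leqP => i _; apply: (leq_trans (size_scale_leq _ _)).
  by rewrite size_polyXn /= /bump leq0n add1n ltn_subrL /=; case: n i {q} => // -[].
by rewrite size_polyDl// size_polyXn monicE lead_coefDl// lead_coefXn.
Qed.

Lemma Pn_factor n s :
  {zs : seq R[i] | size zs = n & Pn n s = \prod_(z <- zs) ('X - z%:P)}.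
Proof.
have [sP mP] := Pn_monic n s.
have [zs zsE] := closed_field_poly_normal (Pn n s).
have PE : Pn n s = \prod_(z <- zs) ('X - z%:P).
  by rewrite zsE (eqP mP) scale1r.
by exists zs => //; apply/eqP; rewrite -eqSS -sP PE size_prod_XsubC.
Qed.

Lemma Pn_at0 n s : (Pn n s).[0] = (ascfact s n)%:C.
Proof.
rewrite /Pn horner_sum big_ord_recr /= big1 ?add0r => [|i _].
  by rewrite subnn expr0 hornerZ hornerC mulr1.
by rewrite hornerZ hornerXn expr0n subn_eq0 leqNgt ltn_ord mulr0.
Qed.

Lemma expi_cos1 a : cos a = 1 -> expi a = 1.
Proof.
move=> ca; rewrite /expi ca; congr (_ +i* _).
by apply/eqP; rewrite -sqrf_eq0 sin2cos2 ca expr1n subrr.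
Qed.

(** Otherwise [z] would lie on the closed ray of angle [a], where [Pn_ray_gt0] excludes roots. *)
Lemma slit_root_rotate n s a z : 0 < s -> - pi < a < pi ->
  cos (n.+1%:R * a) = 1 -> root (Pn n s) z -> slit (- (z * expi (- a))).
Proof.
move=> s0 ha ca /rootP Pz; set w := z * _.
have zE : z = w * expi a by rewrite -mulrA -expiD addNr expi0 mulr1.
rewrite /slit; case: w zE => x y /= zE.
rewrite oppr_eq0 oppr_gt0; have [y0|//] := eqVneq y 0.
rewrite /= ltNge; apply/negP => x0.
have := Pn_ray_gt0 s0 x0 ha ca.
have -> : x%:C * expi a = z by rewrite zE y0.
by rewrite Pz mulr0 ltxx.
Qed.

(** By [carg_sum_bound] with [b = a/2], the sum [S] satisfies [|S - a| < pi]. Comparing the product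
    of the roots with [P_n(s, 0) = s^(n) > 0] shows that [e^(i(S - a))] is a positive real, so
    [S = a]. *)
Lemma roots_carg_sum n s a zs : 0 < s -> - pi < a < pi ->
  cos (n.+1%:R * a) = 1 -> size zs = n ->
  Pn n s = \prod_(z <- zs) ('X - z%:P) ->
  \sum_(z <- zs) carg (- (z * expi (- a))) = a.
Proof.
move=> s0 ha ca szs PE.
have sl : {in [seq z * expi (- a) | z <- zs], forall w, slit (- w)}.
  move=> _ /mapP[z zzs ->]; apply: (slit_root_rotate s0 ha ca).
  by rewrite PE root_prod_XsubC.
have rot : expi (- a) ^+ n = expi a.
  have e1 := expi_cos1 ca.
  rewrite -expiMn -[RHS]mul1r -[in RHS](_ : expi (n.+1%:R * - a) = 1).
    by rewrite -expiD -[n.+1%:R]natr1; congr expi; ring.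
  by rewrite mulrN expi_cos1// cosN.
(* Each factor is [(1 - u) e^(-ia)] times [r e^(ia) - z] with [r = u / (1 - u)]; by [rot] the [n]
   rotations multiply to [e^(ia)]. *)
have ray u : 0 <= u < 1 -> \prod_(w <- [seq z * expi (- a) | z <- zs]) ray_path w u =
    ((1 - u) ^+ n)%:C * expi a * (Pn n s).[(u / (1 - u))%:C * expi a].
  move=> /andP[u0 u1]; rewrite big_map PE horner_prod.
  have -> : ((1 - u) ^+ n)%:C * expi a = \prod_(z <- zs) ((1 - u)%:C * expi (- a)).
    by rewrite -rot rmorphXn -exprMn big_const_seq count_predT szs iter_mulr_1.
  rewrite -big_split /=; apply: eq_bigr => z _.
  rewrite hornerXsubC mulrBr /ray_path; congr (_ - _); last first.
    by rewrite -mulrA; congr (_ * _); exact: mulrC.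
  rewrite mulrACA -rmorphM /= -expiD addNr expi0 mulr1; congr (_%:C).
  by rewrite mulrC mulfVK// subr_eq0 gt_eqF.
have [h1 h2] : - (pi / 2) < a / 2 /\ a / 2 < pi / 2 by case/andP: ha; split; lra.
have cpos : 0 < cos (a / 2) by apply: cos_gt0_pihalf; rewrite h1.
have Hray u : 0 <= u <= 1 -> 0 < complex.Re (expi (- (a / 2)) *
    \prod_(w <- [seq z * expi (- a) | z <- zs]) ray_path w u).
  move=> /andP[u0]; rewrite le_eqVlt => /predU1P[->|u1].
    rewrite big1 => [|w _]; first by rewrite mulr1 /= cosN.
    by rewrite /ray_path subrr mul0r subr0.
  rewrite ray ?u0//.
  set P := (_).[_]; set c := (1 - u) ^+ n.
  have -> : expi (- (a / 2)) * (c%:C * expi a * P) = c%:C * (expi (a / 2) * P).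
    have -> : expi (a / 2) = expi (- (a / 2)) * expi a by rewrite -expiD; congr expi; field.
    by ring.
  rewrite Re_real_mul mulr_gt0 ?exprn_gt0 ?subr_gt0//.
  by apply: Pn_ray_gt0 => //; rewrite divr_ge0// subr_ge0 ltW.
have hb : - (pi / 2) < a / 2 < pi / 2 by rewrite h1.
have := carg_sum_bound sl hb Hray; rewrite big_map => /andP[].
set S := \sum_(z <- zs) _ => S1 S2.
have [|r r0] := @polar_form_prod _ [seq - (z * expi (- a)) | z <- zs].
  by move=> _ /mapP[z zzs ->]; apply: sl; exact: map_f.
rewrite !big_map -/S => SE.
have : (ascfact s n)%:C = r%:C * expi (S - a).
  rewrite expiD mulrA -SE.
  have := ray 0; rewrite lexx ltr01 => /(_ isT).
  rewrite mul0r mul0r subr0 expr1n mul1r Pn_at0 big_map.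
  under eq_bigr => z _ do rewrite /ray_path subr0 mul1r sub0r.
  by move=> ->; rewrite mulrAC -expiD subrr expi0 mul1r.
move=> /(congr1 (@complex.Im R)) /= /esym/eqP.
rewrite mul0r addr0 mulf_eq0 (gt_eqF r0) /= => /eqP sS.
apply/eqP; rewrite -subr_eq0; apply/eqP.
have [Sa|Sa|//] := ltgtP (S - a) 0.
  have := @sin_gt0_pi R (- (S - a)); rewrite sinN sS oppr0 ltxx.
  by move=> h; suff : false by []; apply: h; apply/andP; split; lra.
have := @sin_gt0_pi R (S - a); rewrite sS ltxx.
by move=> h; suff : false by []; apply: h; apply/andP; split; lra.
Qed.
End RootArguments.

(** * Counting the roots between two rays *)

Section Counting.
Context {R : realType}.
Implicit Types (a s r : R) (z : R[i]) (zs : seq R[i]) (n l m : nat).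

Local Notation normc := (@Normc.normc R).

(* The argument in [(0, 2 pi)] of a complex number off the half-line
   [[0, +oo)]. *)
Definition parg z : R := pi + carg (- z).

Lemma parg_bound z : 0 < parg z < 2 * pi.
Proof.
by have /andP[] := carg_bound (- z); rewrite /parg => ? ?; apply/andP; split; lra.
Qed.

Lemma expiN a : - expi a = expi (a - pi).
Proof.
by apply/eqP; rewrite eq_complex /expi /= cosB sinB cospi sinpi !mulr0 addr0 subr0 !mulrN1 !eqxx.
Qed.

Lemma parg_polar z : slit (- z) -> z = (normc (- z))%:C * expi (parg z).
Proof.
move=> sz; rewrite -[z in LHS]opprK [in LHS](polar_form sz) -mulrN expiN /parg; congr (_ * _).
have -> : pi + carg (- z) = carg (- z) - pi + pi *+ 2 by ring.
by rewrite /expi cosD2pi sinD2pi.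
Qed.

Lemma parg_expi r a : 0 < r -> 0 < a < 2 * pi -> parg (r%:C * expi a) = a.
Proof.
move=> r0 /andP[a0 a2]; rewrite /parg -mulrN expiN carg_expi//; first by ring.
by apply/andP; split; lra.
Qed.

(** The argument is [parg z - a] shifted by [pi] or [- pi], whichever lands in [(-pi, pi)]. The jump
    by [2 pi] as [a] passes [parg z] is what counts roots. *)
Lemma carg_rotate z a : slit (- z) -> 0 <= a <= 2 * pi -> parg z != a ->
  carg (- (z * expi (- a))) = parg z - pi - a + 2 * pi * (parg z < a)%R%:R.
Proof.
move=> sz /andP[a0 a2]; have /andP[p0 p2] := parg_bound z.
have -> : z * expi (- a) = (normc (- z))%:C * expi (parg z - a).
  by rewrite {1}(parg_polar sz) -mulrA -expiD.
move=> /lt_total/orP[h|h].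
  rewrite h mulr1 -mulrN expiN.
  have -> : expi (parg z - a - pi) = expi (parg z + pi - a).
    have -> : parg z + pi - a = parg z - a - pi + pi *+ 2 by ring.
    by rewrite /expi cosD2pi sinD2pi.
  rewrite carg_expi ?normc_gt0//; first by ring.
  by apply/andP; split; lra.
rewrite ltNge (ltW h) mulr0 addr0 -mulrN expiN carg_expi ?normc_gt0//; first by ring.
by apply/andP; split; lra.
Qed.

Lemma root_angle0 n : root_angle R n.+1 0 = 0.
Proof. by rewrite /root_angle mulr0 mul0r. Qed.

Lemma root_angleM n l : n.+1%:R * root_angle R n.+1 l = 2 * pi * l%:R.
Proof. by rewrite /root_angle mulrC divfK// pnatr_eq0. Qed.

Lemma root_angle_lt n l m : (root_angle R n.+1 l < root_angle R n.+1 m) = (l < m)%N.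
Proof.
by rewrite /root_angle ltr_pM2r ?invr_gt0 ?ltr0n// ltr_pM2l ?ltr_nat// mulr_gt0 ?pi_gt0.
Qed.

Lemma root_angle_ltpi n l : (root_angle R n.+1 l < pi) = (l.*2 < n.+1)%N.
Proof.
rewrite /root_angle ltr_pdivrMr ?ltr0n//.
have -> : 2 * pi * l%:R = pi * l.*2%:R :> R by rewrite -muln2 natrM; ring.
by rewrite ltr_pM2l ?pi_gt0// ltr_nat.
Qed.

Lemma root_angle_gtpi n l : (pi < root_angle R n.+1 l) = (n.+1 < l.*2)%N.
Proof.
rewrite /root_angle ltr_pdivlMr ?ltr0n//.
have -> : 2 * pi * l%:R = pi * l.*2%:R :> R by rewrite -muln2 natrM; ring.
by rewrite ltr_pM2l ?pi_gt0// ltr_nat.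
Qed.

Lemma root_angle_max n : root_angle R n.+1 n.+1 = 2 * pi.
Proof. by rewrite /root_angle mulfK// pnatr_eq0. Qed.

Lemma root_angle_bound n l : (l <= n.+1)%N -> 0 <= root_angle R n.+1 l <= 2 * pi.
Proof.
move=> hl; rewrite -(root_angle_max n) -{1}(root_angle0 n) !leNgt !root_angle_lt.
by rewrite ltn0 -leqNgt.
Qed.

Lemma cos_2pi_nat l : cos (2 * pi * l%:R) = 1 :> R.
Proof.
elim: l => [|l IH]; first by rewrite mulr0 cos0.
have -> : 2 * pi * l.+1%:R = 2 * pi * l%:R + pi *+ 2 :> R by rewrite -[l.+1%:R]natr1; ring.
by rewrite cosD2pi.
Qed.

(** Rays past the negative real line are turned back by [2 pi], because the results on rays ask for
    an angle in [(-pi, pi)]. *)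
Definition principal_angle n l : R :=
  root_angle R n.+1 l - 2 * pi * (n.+1 < l.*2)%N%:R.

Lemma principal_angle_bound n l : (l <= n.+1)%N -> l.*2 != n.+1 ->
  - pi < principal_angle n l < pi.
Proof.
move=> hl hl2; have /andP[h1 h2] := root_angle_bound hl; rewrite /principal_angle.
have := pi_gt0 R.
case: (ltngtP l.*2 n.+1) hl2 => // h _;
  [rewrite -root_angle_ltpi in h|rewrite -root_angle_gtpi in h];
  rewrite ?mulr0 ?mulr1; move=> ?; apply/andP; split; lra.
Qed.

Lemma expi_principal_angle n l :
  expi (- principal_angle n l) = expi (- root_angle R n.+1 l).
Proof.
rewrite /principal_angle; case: (_ < _)%N; last by rewrite mulr0 subr0.
have -> : - (root_angle R n.+1 l - 2 * pi * 1) = - root_angle R n.+1 l + pi *+ 2 by ring.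
by rewrite /expi cosD2pi sinD2pi.
Qed.

Lemma cos_principal_angle n l : cos (n.+1%:R * principal_angle n l) = 1.
Proof.
rewrite mulrBr root_angleM.
have -> : n.+1%:R * (2 * pi * (n.+1 < l.*2)%N%:R) =
    2 * pi * (n.+1 * (n.+1 < l.*2))%N%:R :> R by rewrite natrM; ring.
have sin0 k : sin (2 * pi * k%:R) = 0 :> R.
  by apply/eqP; rewrite -sqrf_eq0 sin2cos2 cos_2pi_nat expr1n subrr.
by rewrite cosB !cos_2pi_nat !sin0 mulr0 addr0 mulr1.
Qed.

Lemma slit_root n s z : 0 < s -> root (Pn n s) z -> slit (- z).
Proof.
move=> s0 rz; have := @slit_root_rotate _ n s 0 z s0.
rewrite oppr0 expi0 mulr1; apply => //; last by rewrite mulr0 cos0.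
by rewrite oppr_lt0 pi_gt0.
Qed.

(** The excluded ray, [l.*2 = n.+1], is the negative real line, which does carry a root. *)
Lemma parg_root_neq n s z l : 0 < s -> root (Pn n s) z -> (l <= n.+1)%N ->
  l.*2 != n.+1 -> parg z != root_angle R n.+1 l.
Proof.
move=> s0 rz hl hl2; apply/eqP => pz.
have := slit_root_rotate s0 (principal_angle_bound hl hl2) (cos_principal_angle n l) rz.
rewrite expi_principal_angle {1}(parg_polar (slit_root s0 rz)) pz -mulrA -expiD.
rewrite subrr expi0 mulr1 /slit /= oppr0 eqxx /= oppr_gt0.
by rewrite ltNge ltW// normc_gt0// (slit_root s0 rz).
Qed.

Section Roots.
Variables (n : nat) (s : R) (zs : seq R[i]).
Hypotheses (s0 : 0 < s) (szs : size zs = n).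
Hypothesis PE : Pn n s = \prod_(z <- zs) ('X - z%:P).

Let root_mem z : (z \in zs) = root (Pn n s) z.
Proof. by rewrite PE root_prod_XsubC. Qed.

Let below l z := parg z < root_angle R n.+1 l.

Lemma sum_parg_count l : (l <= n.+1)%N -> l.*2 != n.+1 ->
  \sum_(z <- zs) (parg z - pi) - n%:R * root_angle R n.+1 l +
    2 * pi * (count (below l) zs)%:R = principal_angle n l.
Proof.
move=> hl hl2.
rewrite -[RHS](roots_carg_sum s0 (principal_angle_bound hl hl2)
  (cos_principal_angle n l) szs PE).
have -> : \sum_(z <- zs) carg (- (z * expi (- principal_angle n l))) =
    \sum_(z <- zs) ((parg z - pi) + (- root_angle R n.+1 l + 2 * pi * (below l z)%:R)).
  rewrite big_seq [RHS]big_seq; apply: eq_bigr => z; rewrite root_mem => rz.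
  rewrite expi_principal_angle carg_rotate ?addrA//.
  - exact: slit_root rz.
  - exact: root_angle_bound.
  - exact: parg_root_neq rz hl hl2.
rewrite [RHS]big_split [X in _ = _ + X]big_split /= -mulr_sumr -addrA; congr (_ + (_ + _ * _)).
  by rewrite big_const_seq count_predT szs iter_addr_0 mulr_natl mulNrn.
by rewrite -sum1_count natr_sum big_mkcond /=; apply: eq_bigr => z _; case: (below l z).
Qed.

Lemma count_below l : (l <= n.+1)%N -> l.*2 != n.+1 ->
  (count (below l) zs + (n.+1 < l.*2) = l)%N.
Proof.
move=> hl hl2; have := sum_parg_count hl hl2.
(* The case [l = 0] gives the value [0] to the unknown sum of [parg z - pi]. What remains is [2 pi]
   times the count on one side and [(n + 1)] times the root angle, that is [2 pi l], with its
   correction on the other. *)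
have := @sum_parg_count 0 isT isT.
have -> : count (below 0) zs = 0%N.
  rewrite (eq_count (a2 := pred0)) ?count_pred0// => z.
  by rewrite /below root_angle0 ltNge ltW//; case/andP: (parg_bound z).
rewrite /principal_angle root_angle0 !mulr0 subr0 addr0 subr0 => ->.
rewrite add0r => h; have := root_angleM n l; rewrite -[n.+1%:R]natr1 => h2.
have pi0 : 2 * pi != 0 :> R by rewrite gt_eqF// mulr_gt0 ?pi_gt0.
apply/eqP; rewrite -(eqr_nat R) natrD; apply/eqP/(mulfI pi0).
by rewrite mulrDr; lra.
Qed.

Definition wedge l m z := root_angle R n.+1 l < parg z < root_angle R n.+1 m.

(** No root lies on ray [l], so the roots below ray [m] split into those below ray [l] and those in
    the wedge. The count drops by one when the wedge crosses the negative real line. *)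
Lemma count_wedge l m : (l < m <= n.+1)%N -> l.*2 != n.+1 -> m.*2 != n.+1 ->
  (count (wedge l m) zs + l + (n.+1 < m.*2) = m + (n.+1 < l.*2))%N.
Proof.
move=> /andP[lm mn] hl hm.
have ln : (l <= n.+1)%N by apply: leq_trans mn; exact: ltnW.
have := count_below mn hm; have := count_below ln hl.
suff -> : count (below m) zs = (count (wedge l m) zs + count (below l) zs)%N by lia.
rewrite -!sum1_count [LHS]big_mkcond [X in _ = (X + _)%N]big_mkcond
  [X in _ = (_ + X)%N]big_mkcond /= -big_split /= big_seq [RHS]big_seq.
apply: eq_bigr => z; rewrite root_mem => rz; rewrite /wedge /below.
have := parg_root_neq s0 rz ln hl.
have : root_angle R n.+1 l < root_angle R n.+1 m by rewrite root_angle_lt.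
move=> lm'; case: (ltgtP (parg z) (root_angle R n.+1 l)) => //= h _.
  by rewrite (lt_trans h lm').
by rewrite addn0.
Qed.

Lemma count1_unique (p : pred R[i]) : count p zs = 1%N ->
  exists! z, p z /\ root (Pn n s) z.
Proof.
move=> cp; have /hasP[z zzs pz] : has p zs by rewrite has_count cp.
exists z; split=> [|z' [pz' rz']]; first by rewrite -root_mem.
move: cp; rewrite -size_filter.
have : z \in seq.filter p zs by rewrite mem_filter pz.
have : z' \in seq.filter p zs by rewrite mem_filter pz' root_mem.
by case: (seq.filter p zs) => [|x [|//]]//; rewrite !inE => /eqP -> /eqP ->.
Qed.

Lemma mup_le1 (p : pred R[i]) z : (count p zs <= 1)%N -> p z ->
  root (Pn n s) z -> mup z (Pn n s) = 1%N.
Proof.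
move=> cp pz rz; rewrite PE mu_prod_XsubC; apply/eqP; rewrite eqn_leq; apply/andP; split.
  by apply: leq_trans cp; apply: sub_count => x /= /eqP ->.
by rewrite -has_count has_pred1 root_mem.
Qed.
End Roots.
End Counting.

(** * Sectors, the negative real line, and the bound on a negative root *)

Section Sectors.
Context {R : realType}.
Implicit Types (s r x y : R) (z : R[i]) (n l m : nat).

Local Notation normc := (@Normc.normc R).

Lemma sector_wedge n l z : slit (- z) -> (l < n.+1)%N ->
  sector R n.+1 l z <-> wedge n l l.+1 z.
Proof.
move=> sz ln; split=> [[r [phi [r0 /andP[h1 h2] ->]]]|h].
  have /andP[a0 _] := @root_angle_bound R _ _ (ltnW ln).
  have /andP[_ b2] := @root_angle_bound R _ _ ln.
  rewrite /wedge parg_expi ?h1//; apply/andP; split; lra.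
exists (normc (- z)), (parg z); split; [exact: normc_gt0|exact: h|exact: parg_polar].
Qed.

Lemma expi_pi : expi pi = -1 :> R[i].
Proof. by apply/eqP; rewrite eq_complex /expi /= cospi sinpi oppr0 !eqxx. Qed.

Lemma neg_real_polar x : x%:C = (- x)%:C * expi pi.
Proof. by rewrite expi_pi mulrN1 -rmorphN opprK. Qed.

Lemma negative_real_line_sub_sector n l : n = l.*2 ->
  negative_real_line R `<=` sector R n.+1 l.
Proof.
move=> nl z [x x0 ->]; exists (- x), pi; split; [by rewrite oppr_gt0| |exact: neg_real_polar].
by rewrite root_angle_ltpi root_angle_gtpi nl; lia.
Qed.

Lemma negative_real_line_half_line n l : n.+1 = l.*2 ->
  negative_real_line R = half_line R n.+1 l.
Proof.
move=> nl; have angle_pi : root_angle R n.+1 l = pi.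
  by apply/eqP; rewrite eq_le !leNgt root_angle_ltpi root_angle_gtpi nl ltnn.
apply/seteqP; split=> z [r r0 ->]; exists (- r); rewrite ?oppr_gt0 ?oppr_lt0//.
  by rewrite angle_pi; exact: neg_real_polar.
by rewrite angle_pi [RHS]neg_real_polar opprK.
Qed.

Lemma parg_neg_real x : x < 0 -> parg x%:C = pi.
Proof.
move=> x0; rewrite neg_real_polar parg_expi ?oppr_gt0// pi_gt0 /=.
by have := pi_gt0 R; lra.
Qed.

Lemma Pn_real n s x : (Pn n s).[x%:C] = (\sum_(k < n.+1) ascfact s k * x ^+ (n - k))%:C.
Proof.
rewrite /Pn horner_sum rmorph_sum; apply: eq_bigr => k _.
by rewrite hornerZ hornerXn rmorphM rmorphXn.
Qed.

Lemma root_conj n s z : root (Pn n s) z -> root (Pn n s) z^*.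
Proof.
move=> /rootP Pz; apply/rootP.
have -> : (Pn n s).[z^*] = ((Pn n s).[z])^*.
  rewrite /Pn !horner_sum rmorph_sum; apply: eq_bigr => k _.
  by rewrite !hornerZ !hornerXn rmorphM rmorphXn /= oppr0.
by rewrite Pz conjc0.
Qed.

Lemma parg_conj z : parg z^* = 2 * pi - parg z.
Proof.
rewrite /parg /carg; case: z => x y /=.
by rewrite !sqrrN !mulNr !atanN; ring.
Qed.

(* With [K t = (r^(n+1) - t^(n+1)) / (r + t)] one has
   [2 r K t - (r^(n+1) - t^(n+1)) = (r - t) K t >= 0], and the functional
   [t^k |-> s^(k)] maps [K] to [- P_n(s, -r)]. *)
Lemma real_root_bound n s r : odd n -> 0 < s -> 0 < r ->
  root (Pn n s) (- r)%:C -> r ^+ n.+1 < ascfact s n.+1.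
Proof.
move=> on s0 r0 /rootP; rewrite Pn_real => -[P0].
pose g k := (-1) ^+ k * r ^+ (n - k) : R.
(* These are the coefficients of [2 r K t - (r^(n+1) - t^(n+1))]. As [K] has degree [n], with
   coefficients [g], the top coefficient [1] comes from [t^(n+1)] alone. *)
pose f k := if k == n.+1 then 1 else 2 * r * g k - r ^+ n.+1 * (k == 0)%:R.
have fE (h : nat -> R) : \sum_(k < n.+2) f k * h k =
    h n.+1 + 2 * r * (\sum_(k < n.+1) g k * h k) - r ^+ n.+1 * h 0%N.
  rewrite big_ord_recr /= {2}/f eqxx mul1r addrC -addrA; congr (_ + _).
  rewrite mulr_sumr big_ord_recl [in RHS]big_ord_recl /f /= mulr1 mulrBl -!mulrA addrAC.
  congr (_ + _ - _).
  apply: eq_bigr => i _; rewrite /bump /= add1n eqSS (ltn_eqF (ltn_ord i)) mulr0 subr0.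
  by rewrite -!mulrA.
have LK : \sum_(k < n.+1) g k * ascfact s k = 0.
  have -> : \sum_(k < n.+1) g k * ascfact s k =
      - \sum_(k < n.+1) ascfact s k * (- r) ^+ (n - k).
    rewrite -sumrN; apply: eq_bigr => k _.
    rewrite /g (exprNn r) -[in RHS]signr_odd oddB ?leq_ord// on /= signrN signr_odd; ring.
  by rewrite P0 oppr0.
have gE t : (r + t) * \sum_(k < n.+1) g k * t ^+ k = r ^+ n.+1 - t ^+ n.+1.
  have := subrXX r (- t) n.+1; rewrite opprK.
  rewrite [(- t) ^+ _]exprNn -signr_odd /= on /= expr0 mul1r => ->; congr (_ * _).
  by apply: eq_bigr => k _; rewrite /g /= (exprNn t); ring.
suff : 0 < \sum_(k < n.+2) f k * ascfact s k.
  by rewrite fE LK [ascfact s 0]big_ord0 mulr0 addr0 mulr1 subr_gt0.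
apply: ascfact_moment_gt0 => // [t t0|].
  rewrite fE expr0 mulr1 -(@pmulr_rge0 _ (r + t)); last by rewrite ltr_wpDr.
  have -> : (r + t) * (t ^+ n.+1 + 2 * r * (\sum_(k < n.+1) g k * t ^+ k) - r ^+ n.+1) =
      (r - t) * (r ^+ n.+1 - t ^+ n.+1).
    have -> : (r + t) * (t ^+ n.+1 + 2 * r * (\sum_(k < n.+1) g k * t ^+ k) - r ^+ n.+1) =
      2 * r * ((r + t) * \sum_(k < n.+1) g k * t ^+ k) - (r + t) * (r ^+ n.+1 - t ^+ n.+1).
      by ring.
    by rewrite gE; ring.
  have [rt|/ltW tr] := leP r t.
    by rewrite mulr_le0 ?subr_le0// lerXn2r// nnegrE// ltW.
  by rewrite mulr_ge0 ?subr_ge0// lerXn2r// nnegrE// ltW.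
rewrite /f /g /= expr0 subn0 mul1r mulr1 exprS.
have -> : 2 * r * r ^+ n - r * r ^+ n = r * r ^+ n by ring.
by rewrite mulr_gt0// exprn_gt0.
Qed.
End Sectors.

(** * One root per sector, simplicity, and the negative real root *)

Section Wedges.
Context {R : realType}.
Implicit Types (s x y : R) (z : R[i]) (n l m : nat).

Lemma ex_root_angle_step n z : exists2 l, (l <= n)%N &
  root_angle R n.+1 l < parg z <= root_angle R n.+1 l.+1.
Proof.
have /andP[p0 p2] := parg_bound z.
have exl : exists l, root_angle R n.+1 l < parg z by exists 0%N; rewrite root_angle0.
have ubl l : root_angle R n.+1 l < parg z -> (l <= n.+1)%N.
  by move=> hl; rewrite ltnW// -(@root_angle_lt R n) root_angle_max; exact: lt_trans hl p2.
have [l hl lmax] := ex_maxnP exl ubl.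
have ln : (l <= n)%N.
  by rewrite -ltnS -(@root_angle_lt R n) root_angle_max; exact: lt_trans hl p2.
exists l => //; rewrite hl leNgt /=; apply/negP => /lmax.
by rewrite ltnn.
Qed.

(** Both bounding rays lie strictly on the same side of the negative real line, so the two
    corrections in [count_wedge] cancel. *)
Lemma one_root_in_sector n s l : 0 < s -> (l < n.+1)%N ->
  (l.+1.*2 < n.+1)%N || (n.+1 < l.*2)%N -> one_root_in (Pn n s) (sector R n.+1 l).
Proof.
move=> s0 ln hl; have [zs szs PE] := Pn_factor n s.
have cw : count (wedge n l l.+1) zs = 1%N.
  have lln : (l < l.+1 <= n.+1)%N by rewrite ltnSn.
  have h1 : l.*2 != n.+1 by lia.
  have h2 : l.+1.*2 != n.+1 by lia.
  by have := count_wedge s0 szs PE lln h1 h2; lia.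
have [z [[wz rz] zu]] := count1_unique PE cw.
exists z; split=> [|z' [sz rz']].
  by split=> //; apply/sector_wedge => //; exact: slit_root rz.
by apply: zu; split=> //; apply/sector_wedge => //; exact: slit_root rz'.
Qed.

(** Every root lies in a wedge that holds at most one root counted with multiplicity. *)
Lemma Pn_simple_root n s z : (0 < n)%N -> 0 < s -> root (Pn n s) z ->
  mup z (Pn n s) = 1%N.
Proof.
move=> n0 s0 rz; have [zs szs PE] := Pn_factor n s.
have [l ln /andP[lz zl]] := ex_root_angle_step n z.
suff [[k m] /= [kmn hk hm /andP[kz zm] cw]] : exists km : nat * nat,
    [/\ (km.1 < km.2 <= n.+1)%N, km.1.*2 != n.+1, km.2.*2 != n.+1,
        root_angle R n.+1 km.1 < parg z < root_angle R n.+1 km.2 &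
        (km.2 + (n.+1 < km.1.*2) <= km.1 + (n.+1 < km.2.*2) + 1)%N].
  apply: (mup_le1 PE (p := wedge n k m)) => //; last by rewrite /wedge kz.
  by have := count_wedge s0 szs PE kmn hk hm; lia.
have mono k m : (k <= m)%N -> root_angle R n.+1 k <= root_angle R n.+1 m.
  by move=> km; rewrite leNgt root_angle_lt -leqNgt.
have [lmid|lmid] := boolP ((l.*2 != n.+1) && (l.+1.*2 != n.+1)).
  case/andP: lmid => h1 h2; exists (l, l.+1); split => //=; last by lia.
    by rewrite ltnSn ltnS.
  by rewrite lz lt_neqAle zl andbT; apply: parg_root_neq rz _ h2.
(* Here one bounding ray is the negative real line, of index [M], to which [count_wedge] does not
   apply. The two sectors adjacent to it are merged into the wedge from [M.-1] to [M.+1]. *)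
pose M := n.+1./2; have NM : n.+1 = M.*2 by lia.
have M0 : (0 < M)%N by lia.
exists (M.-1, M.+1) => /=; split; [lia|lia|lia| |lia].
apply/andP; split; first by apply: le_lt_trans lz; apply: mono; lia.
have [lM|lM] := leqP l.+1 M.
  by apply: le_lt_trans zl _; rewrite root_angle_lt; lia.
have -> : M = l by lia.
by rewrite lt_neqAle zl andbT; apply: parg_root_neq rz _ _ => //; lia.
Qed.

(** The wedge formed by the two sectors adjacent to the negative real line and that line holds
    exactly one root. The wedge is stable under conjugation, so this root is real; it is negative
    because [P_n] has no root on [[0, +oo)]. *)
Lemma Pn_real_root n s : odd n -> 0 < s -> exists x,
  [/\ x < 0, root (Pn n s) x%:C & forall y, y < 0 -> root (Pn n s) y%:C -> x = y].
Proof.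
move=> on s0; have [zs szs PE] := Pn_factor n s.
pose M := n.+1./2; have NM : n.+1 = M.*2 by lia.
have M0 : (0 < M)%N by lia.
have cw : count (wedge n M.-1 M.+1) zs = 1%N.
  have h : (M.-1 < M.+1 <= n.+1)%N by lia.
  have h1 : M.-1.*2 != n.+1 by lia.
  have h2 : M.+1.*2 != n.+1 by lia.
  by have := count_wedge s0 szs PE h h1 h2; lia.
have lowpi : root_angle R n.+1 M.-1 < pi by rewrite root_angle_ltpi; lia.
have highpi : pi < root_angle R n.+1 M.+1 by rewrite root_angle_gtpi; lia.
have sympi : root_angle R n.+1 M.-1 + root_angle R n.+1 M.+1 = 2 * pi.
  rewrite -(@root_angle_max R n) /root_angle -mulrDl -mulrDr -natrD; congr (_ * _%:R / _); lia.
have [z [[wz rz] zu]] := count1_unique PE cw.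
have zJ : z = z^*.
  apply: zu; split; last exact: root_conj.
  by move: wz; rewrite /wedge parg_conj => /andP[h1 h2]; apply/andP; split; lra.
have := slit_root s0 rz; case: z zJ wz rz zu => x y [yN] wz rz zu.
have y0 : y = 0 by lra.
move: rz zu; rewrite /slit /= y0 oppr0 eqxx /= oppr_gt0 => rz zu x0.
exists x; split=> // x' x'0 rx'.
have [//] : x%:C = x'%:C.
by apply: zu; split=> //; rewrite /wedge parg_neg_real// lowpi.
Qed.
End Wedges.

Theorem theorem1p1 (R : realType) (n : nat) (s : R) (hn : (0 < n)%N)
    (hs : 0 < s) :
  [/\ (~~ odd n ->
        forall l : 'I_n.+1,
          ~ (negative_real_line R `<=` sector R n.+1 l) ->
          one_root_in (Pn n s) (sector R n.+1 l)),
      (odd n ->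
        (exists x : R,
          unique (fun y : R => y < 0 /\ root (Pn n s) y%:C) x /\
          - (ascfact s n.+1 `^ (n.+1%:R)^-1) < x < 0) /\
        (forall l : 'I_n.+1,
          ~ adjacent_to_negative R n.+1 l ->
          one_root_in (Pn n s) (sector R n.+1 l)))
    & forall z : R[i], root (Pn n s) z -> mup z (Pn n s) = 1%N].
Proof.
split=> [en l hl|on|z]; last exact: Pn_simple_root.
  have ln := ltn_ord l; apply: one_root_in_sector => //.
  (* For even [n] the sector of index [n/2] is the only one not covered by [one_root_in_sector]. *)
  have : n <> l.*2 by move=> /(@negative_real_line_sub_sector R)/hl.
  lia.
split=> [|l hl].
  have [x [x0 rx xu]] := Pn_real_root on hs.
  exists x; split; first by split=> // y [y0 ry]; exact: xu.
  rewrite x0 andbT ltrNl ltNge; apply/negP => hx.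
  have Nx0 : 0 < - x by rewrite oppr_gt0.
  have := @real_root_bound R n s (- x) on hs Nx0; rewrite opprK => /(_ rx).
  rewrite ltNge => /negP; apply.
  have a0 := ltW (@ascfact_gt0 R s n.+1 hs).
  have -> : ascfact s n.+1 = (ascfact s n.+1 `^ (n.+1%:R)^-1) ^+ n.+1.
    by rewrite -powR_mulrn ?powR_ge0// -powRrM mulVf ?pnatr_eq0// powRr1.
  by rewrite lerXn2r// nnegrE ?powR_ge0// ltW.
have ln := ltn_ord l; apply: one_root_in_sector => //.
have h1 : n.+1 <> l.*2.
  by move=> /(@negative_real_line_half_line R) h; apply: hl; left.
have h2 : n.+1 <> l.+1.*2.
  by move=> /(@negative_real_line_half_line R) h; apply: hl; right.
lia.
Qed.
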